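(* Let $1\to N\xrightarrow{i}G\xrightarrow{p}\Gamma\to1$ be an exact sequence of groups. If $\Gamma=G/N$ is boundedly $3$-acyclic, then the map $p^*\circ(\xi_4)^{-1}\circ\tau_{/b}$ induces an isomorphism \[ \mathrm{Q}(N)^G/\big(\mathrm{H}^1(N)^G+i^*\mathrm{Q}(G)\big)\cong\mathrm{Im}(p^* )\cap\mathrm{Im}(c_G), \] where $p^*\colon\mathrm{H}^2(\Gamma)\to\mathrm{H}^2(G)$ is induced by $p$ and $c_G\colon\mathrm{H}^2_b(G)\to\mathrm{H}^2(G)$ is the comparison map. In particular, if $\Gamma$ is boundedly $3$-acyclic, then \[ \dim\big(\mathrm{Q}(N)^G/(\mathrm{H}^1(N)^G+i^*\mathrm{Q}(G))\big)\le\dim\mathrm{H}^2(G). \]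
   Context: A quasimorphism on a group $G$ is a function $f\colon G\to\mathbb{R}$ with $\sup_{x,y\in G}|f(xy)-f(x)-f(y)|<\infty$; it is homogeneous if $f(x^n)=n f(x)$ for all $x\in G$, $n\in\mathbb{Z}$. $\mathrm{Q}(G)$ is the real vector space of homogeneous quasimorphisms on $G$. For a normal subgroup $N$ of $G$ with inclusion $i$: $\mathrm{Q}(N)^G$ is the space of $f\in\mathrm{Q}(N)$ with $f(gxg^{-1})=f(x)$ for all $g\in G$, $x\in N$; $\mathrm{H}^1(N)^G$ is the subspace of $G$-invariant homomorphisms $N\to\mathbb{R}$; $i^*\mathrm{Q}(G)\subseteq\mathrm{Q}(N)^G$ is the space of restrictions to $N$ of elements of $\mathrm{Q}(G)$. All cohomology has trivial real coefficients. $C^n(G)$ is the space of functions $G^{\times n}\to\mathbb{R}$ with the usual inhomogeneous differential $\delta$ (so $\delta F(x,y)=F(y)-F(xy)+F(x)$ for $F\in C^1(G)$), $C^\bullet_b(G)$ the subcomplex of bounded functions, $C^\bullet_{/b}(G)=C^\bullet(G)/C^\bullet_b(G)$; their cohomologies are $\mathrm{H}^\bullet(G)$, $\mathrm{H}^\bullet_b(G)$, $\mathrm{H}^\bullet_{/b}(G)$. The comparison map $c_G\colon\mathrm{H}^\bullet_b(G)\to\mathrm{H}^\bullet(G)$ is induced by inclusion, and $\xi_4\colon\mathrm{H}^2(\Gamma)\to\mathrm{H}^2_{/b}(\Gamma)$ is induced by the quotient map $C^\bullet\to C^\bullet_{/b}$. A group $\Gamma$ is boundedly $k$-acyclic if $\mathrm{H}^j_b(\Gamma)=0$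 for every integer $1\le j\le k$; when $\Gamma$ is boundedly $3$-acyclic, $\xi_4$ is an isomorphism. The map $\tau_{/b}\colon\mathrm{Q}(N)^G\to\mathrm{H}^2_{/b}(\Gamma)$ is defined as follows. For $f\in\mathrm{Q}(N)^G$ choose $F\colon G\to\mathbb{R}$ with $F|_N=f$ and such that $|F(ng)-F(n)-F(g)|$ and $|F(gn)-F(g)-F(n)|$ are bounded uniformly over $g\in G$, $n\in N$ (such $F$ exists), and a set-theoretic section $s\colon\Gamma\to G$ of $p$. Then $(\gamma_1,\gamma_2)\mapsto\delta F(s(\gamma_1),s(\gamma_2))$ represents a cocycle in $C^2_{/b}(\Gamma)$, and $\tau_{/b}(f)$ is its class in $\mathrm{H}^2_{/b}(\Gamma)$, which is independent of the choices of $F$ and $s$. *)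

(* Defs.v *)
From HB Require Import structures.
From mathcomp Require Import all_boot all_order all_algebra.
From mathcomp Require Import ring lra.
From mathcomp Require Import boolp classical_sets functions cardinality reals.

Set Implicit Arguments.
Unset Strict Implicit.
Unset Printing Implicit Defensive.

Import Order.TTheory GRing.Theory Num.Theory.
Local Open Scope ring_scope.
Local Open Scope quotient_scope.
Local Open Scope card_scope.

Section Submod.
Variables (R : pzRingType) (V : lmodType R) (S : submodClosed V).

Record submod := Submod { submod_val :> V; _ : submod_val \in S }.

HB.instance Definition _ := [isSub for submod_val].
HB.instance Definition _ := [Choice of submod by <:].
HB.instance Definition _ := [SubChoice_isSubLmodule of submod by <:].

Lemma submod_eq (x y : submod) : submod_val x = submod_val y -> x = y.
Proof. exact: val_inj. Qed.
End Submod.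

Section Quotmod.
Variables (R : pzRingType) (V : lmodType R) (S : submodClosed V).

Lemma submod_zmod_closed : zmod_closed S.
Proof. exact: GRing.submod_closedB (GRing.submodClosedP S). Qed.

Definition zmodS : zmodClosed V :=
  HB.pack (GRing.SubmodClosed.sort S)
    (GRing.isZmodClosed.Build V (GRing.SubmodClosed.sort S) submod_zmod_closed).

Definition quotmod := Quotient.quot zmodS.
HB.instance Definition _ := GRing.Zmodule.on quotmod.

Definition qpi (x : V) : quotmod := \pi_(Quotient.quot (zmodS)) x.

Lemma qpi_eq x y : (qpi x = qpi y) <-> (x - y \in S).
Proof.
rewrite -[x - y \in S]/(x - y \in zmodS) Quotient.idealrBE.
by split=> [?|/eqP //]; apply/eqP.
Qed.

Lemma qpiD x y : qpi (x + y) = qpi x + qpi y.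
Proof. exact: (raddfD \pi_(Quotient.quot zmodS)). Qed.

Lemma qpiP (q : quotmod) : exists x, q = qpi x.
Proof. by exists (repr q); rewrite /qpi reprK. Qed.

Definition qscale (a : R) (q : quotmod) : quotmod :=
  qpi (a *: (repr (q : Quotient.quot (zmodS)))).

Lemma qscaleE a x : qscale a (qpi x) = qpi (a *: x).
Proof.
apply/qpi_eq; rewrite -scalerBr rpredZ //; apply/qpi_eq.
by rewrite /qpi reprK.
Qed.

Lemma qscaleA a b q : qscale a (qscale b q) = qscale (a * b) q.
Proof. by have [x ->] := qpiP q; rewrite !qscaleE scalerA. Qed.
Lemma qscale1 : left_id 1 qscale.
Proof. by move=> q; have [x ->] := qpiP q; rewrite !qscaleE scale1r. Qed.
Lemma qscaleDr : right_distributive qscale +%R.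
Proof.
move=> a q r; have [x ->] := qpiP q; have [y ->] := qpiP r.
by rewrite -qpiD !qscaleE scalerDr qpiD.
Qed.
Lemma qscaleDl q : {morph qscale^~ q : a b / a + b}.
Proof.
by move=> a b; have [x ->] := qpiP q; rewrite !qscaleE scalerDl qpiD.
Qed.

HB.instance Definition _ :=
  GRing.Zmodule_isLmodule.Build R quotmod qscaleA qscale1 qscaleDr qscaleDl.

Lemma qpi_linear : linear qpi.
Proof. by move=> a x y; rewrite qpiD -qscaleE. Qed.
HB.instance Definition _ := GRing.isLinear.Build R V quotmod _ qpi qpi_linear.

Lemma qpi_eq0 x : (qpi x = 0) <-> (x \in S).
Proof. by rewrite -(linear0 qpi) qpi_eq subr0. Qed.
End Quotmod.
Arguments qpi {R V} S x.

Section SubQuotMaps.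
Variables (R : pzRingType) (U V : lmodType R) (f : {linear U -> V}).
Variables (S : submodClosed U) (T : submodClosed V).
Hypothesis fST : forall x, x \in S -> f x \in T.

Definition submod_map (x : submod S) : submod T := Submod (fST (valP x)).

Lemma submod_map_linear : linear submod_map.
Proof. by move=> a x y; apply: val_inj; rewrite /= !linearP. Qed.
HB.instance Definition _ :=
  GRing.isLinear.Build R (submod S) (submod T) _ submod_map submod_map_linear.

(* The vacuous [let] makes the hypothesis [fST], on which linearity rests, an
   argument of the map. *)
Definition quotmod_map (q : quotmod S) : quotmod T :=
  let _ := fST in
  qpi T (f (repr (q : Quotient.quot (zmodS S)))).

Lemma quotmod_mapE x : quotmod_map (qpi S x) = qpi T (f x).
Proof.
apply/qpi_eq; rewrite -linearB; apply: fST; apply/qpi_eq.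
by rewrite /qpi reprK.
Qed.

Lemma quotmod_map_linear : linear quotmod_map.
Proof.
move=> a q r; have [x ->] := qpiP q; have [y ->] := qpiP r.
by rewrite -linearP !quotmod_mapE !linearP.
Qed.
HB.instance Definition _ := GRing.isLinear.Build R (quotmod S) (quotmod T) _
  quotmod_map quotmod_map_linear.
End SubQuotMaps.
Arguments submod_map {R U V} f {S T} fST x.
Arguments quotmod_map {R U V} f {S T} fST q.

Section SubspaceOps.
Variables (R : pzRingType) (U V : lmodType R).

Definition lin_im (f : {linear U -> V}) : {pred V} :=
  [pred y | `[< exists x, f x = y >]].

Lemma lin_imP (f : {linear U -> V}) y :
  reflect (exists x, f x = y) (y \in lin_im f).
Proof. exact: asboolP. Qed.

Lemma lin_im_submod f : submod_closed (lin_im f).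
Proof.
split=> [|a _ _ /lin_imP[x <-] /lin_imP[y <-]]; apply/lin_imP.
  by exists 0; rewrite linear0.
by exists (a *: x + y); rewrite linearP.
Qed.
HB.instance Definition _ f :=
  GRing.isSubmodClosed.Build R V (lin_im f) (lin_im_submod f).

Variables S T : submodClosed V.

Definition subspace_sum : {pred V} :=
  [pred x | `[< exists s t, [/\ s \in S, t \in T & x = s + t] >]].

Lemma subspace_sumP x :
  reflect (exists s t, [/\ s \in S, t \in T & x = s + t]) (x \in subspace_sum).
Proof. exact: asboolP. Qed.

Lemma subspace_sum_submod : submod_closed subspace_sum.
Proof.
split=> [|a x y /subspace_sumP[s [t [Ss Tt ->]]]
              /subspace_sumP[u [v [Su Tv ->]]]]; apply/subspace_sumP.
  by exists 0, 0; rewrite !rpred0 addr0.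
exists (a *: s + u), (a *: t + v); split; rewrite ?rpredD ?rpredZ //.
by rewrite scalerDr addrACA.
Qed.
HB.instance Definition _ :=
  GRing.isSubmodClosed.Build R V subspace_sum subspace_sum_submod.

Definition subspace_cap : {pred V} := [pred x | (x \in S) && (x \in T)].

Lemma subspace_cap_submod : submod_closed subspace_cap.
Proof.
split=> [|a x y]; rewrite !inE /= ?rpred0 //.
by move=> /andP[Sx Tx] /andP[Sy Ty]; rewrite !rpredD ?rpredZ.
Qed.
HB.instance Definition _ :=
  GRing.isSubmodClosed.Build R V subspace_cap subspace_cap_submod.
End SubspaceOps.

Section Dimension.
Variables (R : pzRingType) (V : lmodType R).

Definition lin_indep (B : set V) :=
  forall (s : seq V) (a : V -> R), uniq s -> (forall v, v \in s -> B v) ->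
    \sum_(v <- s) a v *: v = 0 -> forall v, v \in s -> a v = 0.

Definition spanning (B : set V) :=
  forall x, exists (s : seq V) (a : V -> R),
    (forall v, v \in s -> B v) /\ x = \sum_(v <- s) a v *: v.

Definition basis (B : set V) := lin_indep B /\ spanning B.
End Dimension.

(* Comparison of the cardinalities of bases; all bases of a real vector space
   have the same cardinality, so that the choice of bases is immaterial. *)
Definition dim_le (R : pzRingType) (V W : lmodType R) :=
  exists (B : set V) (C : set W), [/\ basis B, basis C & B #<= C].

Record complex (R : pzRingType) := Complex {
  cochain :> nat -> lmodType R;
  diff : forall n, {linear cochain n -> cochain n.+1};
  diffK : forall n x, diff n.+1 (diff n x) = 0 }.
Arguments diff {R} C n : rename.

Record chain_map (R : pzRingType) (C D : complex R) := ChainMap {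
  cmap :> forall n, {linear C n -> D n};
  cmap_diff : forall n x, cmap n.+1 (diff C n x) = diff D n (cmap n x) }.

Section Cohomology.
Variables (R : pzRingType) (C : complex R).

Definition cocycle n : {pred C n} := [pred z | diff C n z == 0].

Lemma cocycleP n (z : C n) : reflect (diff C n z = 0) (z \in @cocycle n).
Proof. exact: eqP. Qed.

Lemma cocycle_submod n : submod_closed (@cocycle n).
Proof.
split=> [|a x y]; first by rewrite inE /= linear0.
by rewrite !inE /= linearP => /eqP -> /eqP ->; rewrite scaler0 addr0.
Qed.
HB.instance Definition _ n :=
  GRing.isSubmodClosed.Build R (C n) (@cocycle n) (@cocycle_submod n).

Definition coboundary n : C n -> Prop :=
  match n return C n -> Prop with
  | 0 => fun z => z = 0
  | m.+1 => fun z => exists w, z = diff C m w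
  end.

Definition coboundaries n : {pred submod (@cocycle n)} :=
  [pred z | `[< coboundary (val z) >]].

Lemma coboundariesP n (x : submod (@cocycle n)) :
  reflect (coboundary (val x)) (x \in @coboundaries n).
Proof. exact: asboolP. Qed.

Lemma coboundaries_submod n : submod_closed (@coboundaries n).
Proof.
split=> [|a x y].
  by apply/coboundariesP; case: n => //= n; exists 0; rewrite linear0.
move=> /coboundariesP hx /coboundariesP hy; apply/coboundariesP.
case: n => [|n] /= in x y hx hy *; first by rewrite hx hy scaler0 addr0.
by case: hx hy => [v ->] [w ->]; exists (a *: v + w); rewrite linearP.
Qed.
HB.instance Definition _ n := GRing.isSubmodClosed.Build R
  (submod (@cocycle n)) (@coboundaries n) (@coboundaries_submod n).

Definition cohomology n : lmodType R := quotmod (@coboundaries n).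

Definition cohom_class n (z : submod (@cocycle n)) : cohomology n :=
  qpi (@coboundaries n) z.

Lemma cohom_classP n (c : cohomology n) : exists z, c = cohom_class z.
Proof. exact: qpiP. Qed.

Lemma cohom_class_eq n (y z : submod (@cocycle n)) :
  cohom_class y = cohom_class z <-> coboundary (val y - val z).
Proof.
split=> [/qpi_eq/coboundariesP //|h].
by apply/qpi_eq; apply/coboundariesP.
Qed.

Lemma cohom_class_eq0 n (z : submod (@cocycle n)) :
  cohom_class z = 0 <-> coboundary (val z).
Proof.
by rewrite -(linear0 (qpi (@coboundaries n))) cohom_class_eq /= subr0.
Qed.
End Cohomology.

Section CohomologyMap.
Variables (R : pzRingType) (C D : complex R) (f : chain_map C D).

Lemma cmap_cocycle n x : x \in @cocycle R C n -> f n x \in @cocycle R D n.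
Proof. by rewrite !inE /= -cmap_diff => /eqP ->; rewrite linear0. Qed.

Lemma cmap_coboundary n (x : submod (@cocycle R C n)) :
  x \in @coboundaries R C n ->
  submod_map (f n) (@cmap_cocycle n) x \in @coboundaries R D n.
Proof.
move=> /coboundariesP h; apply/coboundariesP.
case: n => [|n] /= in x h *; first by rewrite h linear0.
by case: h => w ->; exists (f n w); rewrite cmap_diff.
Qed.

Definition cohomology_map n : {linear cohomology C n -> cohomology D n} :=
  quotmod_map (submod_map (f n) (@cmap_cocycle n))
    (@cmap_coboundary n).

Lemma cohomology_mapE n z :
  cohomology_map n (cohom_class z) =
  cohom_class (submod_map (f n) (@cmap_cocycle n) z).
Proof. exact: (quotmod_mapE (@cmap_coboundary n)). Qed.
End CohomologyMap.

Section SubQuotComplex.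
Variables (R : pzRingType) (C : complex R) (S : forall n, submodClosed (C n)).
Hypothesis diffS : forall n x, x \in S n -> diff C n x \in S n.+1.

Lemma subcomplexK n (x : submod (S n)) :
  submod_map (diff C n.+1) (@diffS n.+1) (submod_map (diff C n) (@diffS n) x) = 0.
Proof. by apply: val_inj; rewrite /= diffK. Qed.

Definition subcomplex : complex R :=
  @Complex R (fun n => submod (S n)) (fun n => submod_map (diff C n) (@diffS n))
    subcomplexK.

Lemma quotcomplexK n (q : quotmod (S n)) :
  quotmod_map (diff C n.+1) (@diffS n.+1) (quotmod_map (diff C n) (@diffS n) q) = 0.
Proof. by have [x ->] := qpiP q; rewrite !quotmod_mapE diffK linear0. Qed.

Definition quotcomplex : complex R :=
  @Complex R (fun n => quotmod (S n)) (fun n => quotmod_map (diff C n) (@diffS n))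
    quotcomplexK.

Definition sub_incl : chain_map subcomplex C :=
  @ChainMap R subcomplex C (fun n => val) (fun n x => erefl).

Lemma quot_proj_diff n x :
  qpi (S n.+1) (diff C n x) = diff quotcomplex n (qpi (S n) x).
Proof. by rewrite /= quotmod_mapE. Qed.

Definition quot_proj : chain_map C quotcomplex :=
  @ChainMap R C quotcomplex (fun n => qpi (S n)) quot_proj_diff.
End SubQuotComplex.
Arguments subcomplex {R} C S diffS.
Arguments quotcomplex {R} C S diffS.
Arguments sub_incl {R} C S diffS.
Arguments quot_proj {R} C S diffS.

Section GroupCochains.
Variables (R : realType) (G : groupType).

(* [face j (g_1, ..., g_{n+1})] is (g_2, ..., g_{n+1}) if j = 0,
   (g_1, ..., g_j g_{j+1}, ..., g_{n+1}) if 0 < j <= n and (g_1, ..., g_n) if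
   j = n.+1; tuples are indexed from 0. *)
Definition face n (j : nat) (g : 'I_n.+1 -> G) : 'I_n -> G := fun k =>
  let k0 := widen_ord (leqnSn n) k in let k1 := lift ord0 k in
  if (k.+1 < j)%N then g k0
  else if k.+1 == j then (g k0 * g k1)%g else g k1.

Definition gcochain n : lmodType R := ('I_n -> G) -> R^o.

Definition gdiff n (F : gcochain n) : gcochain n.+1 :=
  fun g => \sum_(j < n.+2) (-1) ^+ j * F (face j g).

Lemma gdiff_linear n : linear (@gdiff n).
Proof.
move=> a F H; apply/funext => g.
transitivity (a * gdiff F g + gdiff H g : R^o); last by [].
rewrite /gdiff mulr_sumr -big_split /=.
by apply: eq_bigr => j _; rewrite mulrDr [X in X + _]mulrCA.
Qed.
HB.instance Definition _ n :=
  GRing.isLinear.Build R (gcochain n) (gcochain n.+1) _ (@gdiff n)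
    (@gdiff_linear n).

Lemma face_face n (i j : nat) (g : 'I_n.+2 -> G) : (i <= j)%N ->
  face i (face j.+1 g) = face j (face i g).
Proof.
move=> ij; apply/funext => k; rewrite /face /= /bump /= !add1n.
set a := g _; set b := g _; set c := g _; set d := g _.
have -> : c = b by congr (g _); apply: val_inj; rewrite /= /bump /= add1n.
rewrite !eqSS !ltnS.
case: (ltngtP k.+1 i) => [ki|ik|ki].
- by rewrite (leq_trans ki ij) (leq_trans (ltnW ki) ij).
- by rewrite [(k.+2 < i)%N]ltnNge (leqW (ltnW ik)) /= (gtn_eqF (leqW ik)).
- move: ij; rewrite -ki => kj; rewrite kj.
  by case: (ltngtP k.+1 j) kj => // _ _; rewrite ltnNge leqW //= gtn_eqF // mulgA.
Qed.

Lemma gdiffK n (F : gcochain n) : gdiff (gdiff F) = 0.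
Proof.
apply/funext => g; rewrite /gdiff.
pose A (i j : nat) : R := (-1) ^+ (i + j) * F (face i (face j g)).
transitivity (\sum_(i < n.+2) \sum_(j < n.+3) A i j : R).
  rewrite exchange_big /=; apply: eq_bigr => j _; rewrite mulr_sumr.
  by apply: eq_bigr => i _; rewrite mulrA -exprD addnC.
have AS (i j : nat) : (i <= j)%N -> A i j.+1 = - A j i.
  by move=> ij; rewrite /A face_face // addnS addnC exprS mulN1r mulNr.
transitivity (\sum_(i < n.+2) (\sum_(j < n.+2 | (i <= j)%N) A i j.+1 +
                \sum_(j < n.+2 | (j <= i)%N) A i j)).
  apply: eq_bigr => i _; rewrite (bigID (fun j : 'I_n.+3 => (i < j)%N)) /=.
  congr (_ + _); last under eq_bigl do rewrite -leqNgt.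
    by rewrite big_mkcond big_ord_recl /= add0r [RHS]big_mkcond.
  by rewrite big_mkcond big_ord_recr /= leqNgt ltn_ord addr0 [RHS]big_mkcond.
rewrite big_split /= addrC [X in X + _](exchange_big_dep predT) //=.
rewrite -big_split big1 //= => i _; rewrite -big_split big1 //= => j ij.
by rewrite AS // addrN.
Qed.

Lemma gdiff1E (F : G -> R) (c : 'I_2 -> G) :
  gdiff (fun g : 'I_1 -> G => F (g ord0) : R^o) c =
  F (c ord_max) - F (c ord0 * c ord_max)%g + F (c ord0) :> R.
Proof.
set x := c ord0; set y := c ord_max.
have cE k : c k = if val k == 0%N then x else y.
  by case: k => [[|[|]] // lt]; congr c; apply: val_inj.
clearbody x y.
rewrite /gdiff !big_ord_recl big_ord0 /face /= !cE /= /bump /=.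
by rewrite !exprD !expr1 !expr0 !(mulr1, mulN1r, mul1r, opprK) addr0 addrA.
Qed.

Lemma gdiff2E (F : G -> G -> R) (c : 'I_3 -> G) :
  let x := c ord0 in let y := c (Ordinal (isT : 1 < 3)%N) in
  let z := c ord_max in
  gdiff (fun g : 'I_2 -> G => F (g ord0) (g ord_max) : R^o) c =
  F y z - F (x * y)%g z + F x (y * z)%g - F x y :> R.
Proof.
move=> x y z.
have cE k : c k = if val k == 0%N then x else if val k == 1%N then y else z.
  by case: k => [[|[|[|]]] // lt]; congr c; apply: val_inj.
clearbody x y z.
rewrite /gdiff !big_ord_recl big_ord0 /face /= !cE /= /bump /=.
by rewrite !exprD !expr1 !expr0 !(mulr1, mulN1r, mul1r, opprK) addr0 !addrA.
Qed.

Definition group_complex : complex R :=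
  @Complex R gcochain (fun n => @gdiff n) gdiffK.
End GroupCochains.

Section GroupCohomology.
Variables (R : realType) (G : groupType).

Definition bounded_cochains n : {pred gcochain R G n} :=
  [pred F | `[< exists M : R, forall g, `|(F : _ -> R) g| <= M >]].

Lemma bounded_cochainsP n (F : gcochain R G n) :
  reflect (exists M : R, forall g, `|(F : _ -> R) g| <= M)
    (F \in @bounded_cochains n).
Proof. exact: asboolP. Qed.

Lemma bounded_cochains_submod n : submod_closed (@bounded_cochains n).
Proof.
split=> [|a x y].
  by apply/bounded_cochainsP; exists 0 => g; rewrite normr0.
move=> /bounded_cochainsP[M hM] /bounded_cochainsP[M' hM'].
apply/bounded_cochainsP; exists (`|a| * M + M') => g.
by rewrite (le_trans (ler_normD _ _)) // lerD // normrM ler_wpM2l.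
Qed.
HB.instance Definition _ n := GRing.isSubmodClosed.Build R (gcochain R G n)
  (@bounded_cochains n) (@bounded_cochains_submod n).

Lemma bounded_cochains_diff n (F : gcochain R G n) :
  F \in @bounded_cochains n ->
  diff (group_complex R G) n F \in @bounded_cochains n.+1.
Proof.
move=> /bounded_cochainsP[M hM]; apply/bounded_cochainsP.
exists (\sum_(j < n.+2) M) => g; rewrite /= /gdiff.
apply: le_trans (ler_norm_sum _ _ _) _; apply: ler_sum => j _.
by rewrite normrM normrX normrN1 expr1n mul1r.
Qed.

(* C_b and C / C_b *)
Definition bounded_complex : complex R :=
  subcomplex (group_complex R G) (fun n => @bounded_cochains n)
    bounded_cochains_diff.

Definition modb_complex : complex R :=
  quotcomplex (group_complex R G) (fun n => @bounded_cochains n)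
    bounded_cochains_diff.

Definition gH n : lmodType R := cohomology (group_complex R G) n.
Definition gHb n : lmodType R := cohomology bounded_complex n.
Definition gHmodb n : lmodType R := cohomology modb_complex n.

Definition comparison n : {linear gHb n -> gH n} :=
  cohomology_map (sub_incl (group_complex R G) (fun n => @bounded_cochains n)
    bounded_cochains_diff) n.

Definition to_modb n : {linear gH n -> gHmodb n} :=
  cohomology_map (quot_proj (group_complex R G) (fun n => @bounded_cochains n)
    bounded_cochains_diff) n.

Definition boundedly_acyclic k :=
  forall j, (1 <= j <= k)%N -> forall x : gHb j, x = 0.

Definition xi4 : {linear gH 2 -> gHmodb 2} := to_modb 2.

Definition xi4_inv (y : gHmodb 2) : gH 2 := xget 0 [set x | xi4 x = y]%classic.

Lemma bounded_cocycle_exact n (F : gcochain R G n.+1) :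
  (forall x : gHb n.+1, x = 0) -> F \in @bounded_cochains n.+1 ->
  gdiff F = 0 -> exists2 b, b \in @bounded_cochains n & F = gdiff b.
Proof.
move=> H0 BF dF; pose F' : bounded_complex n.+1 := Submod BF.
have zF : F' \in @cocycle R bounded_complex n.+1.
  by apply/cocycleP; apply: submod_eq.
have /cohom_class_eq0[b /(congr1 (@submod_val _ _ _)) /= ->] := H0 (cohom_class (Submod zF)).
by exists (val b); first exact: valP.
Qed.

Lemma xi4_inj : boundedly_acyclic 3 -> injective xi4.
Proof.
move=> Hac; suff xi40 x : xi4 x = 0 -> x = 0.
  move=> x y /eqP; rewrite -subr_eq0 -linearB => /eqP/xi40/eqP.
  by rewrite subr_eq0 => /eqP.
have [[F zF] ->] := cohom_classP x.
rewrite /xi4 /to_modb cohomology_mapE => /cohom_class_eq0[w].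
have [w0 ->] := qpiP w; rewrite /= quotmod_mapE => /qpi_eq Bb.
have dF : gdiff F = 0 := elimT (cocycleP _) zF.
have [||b Bb' /eqP] := bounded_cocycle_exact _ Bb; first exact: Hac.
  transitivity (gdiff F - gdiff (gdiff w0)); last by rewrite dF gdiffK subrr.
  exact: (linearB (@gdiff R G 2)).
rewrite subr_eq => /eqP FE; apply: (cohom_class_eq0 (Submod zF)).2.
by exists (b + w0); apply: etrans FE _; exact/esym/(linearD (@gdiff R G 1)).
Qed.

Lemma xi4_surj : boundedly_acyclic 3 -> forall y, exists x, xi4 x = y.
Proof.
move=> Hac y; have [[q zq] ->] := cohom_classP y.
have [F qE] := qpiP q; have BdF : gdiff F \in @bounded_cochains 3.
  by have := elimT (cocycleP _) zq; rewrite {1}qE /= quotmod_mapE => /qpi_eq0.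
have [||b Bb dFE] := bounded_cocycle_exact _ BdF; first exact: Hac.
  exact: gdiffK.
have zFb : F - b \in @cocycle R (group_complex R G) 2.
  apply/cocycleP; transitivity (gdiff F - gdiff b); last by rewrite dFE subrr.
  exact: (linearB (@gdiff R G 2)).
exists (cohom_class (Submod zFb)).
rewrite /xi4 /to_modb cohomology_mapE; congr cohom_class; apply: submod_eq.
apply: etrans (esym qE); apply/qpi_eq.
by rewrite addrAC subrr add0r -scaleN1r rpredZ.
Qed.

Lemma xi4_bij : boundedly_acyclic 3 -> bijective xi4.
Proof.
move=> Hac; have [g gK] := choice (xi4_surj Hac).
by exists g => // x; apply: (xi4_inj Hac); rewrite gK.
Qed.

Lemma xi4K : boundedly_acyclic 3 -> cancel xi4 xi4_inv.
Proof.
move=> /xi4_bij/bij_inj inj x; rewrite /xi4_inv.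
by case: xgetP => [y _ /inj //|/(_ x erefl)].
Qed.

Lemma xi4_invK : boundedly_acyclic 3 -> cancel xi4_inv xi4.
Proof.
move=> Hac x; have [g _ xiK] := xi4_bij Hac; rewrite /xi4_inv.
by case: xgetP => [y _ //|/(_ (g x) (xiK x))].
Qed.
End GroupCohomology.

Section Pullback.
Variables (R : realType) (G H : groupType) (p : {multiplicative G -> H}).

Definition pullback_cochain n (F : gcochain R H n) : gcochain R G n :=
  fun g => F (p \o g).

Lemma pullback_cochain_linear n : linear (@pullback_cochain n).
Proof. by []. Qed.
HB.instance Definition _ n := GRing.isLinear.Build R (gcochain R H n)
  (gcochain R G n) _ (@pullback_cochain n) (@pullback_cochain_linear n).

Lemma pullback_diff n (F : gcochain R H n) :
  pullback_cochain (diff (group_complex R H) n F) =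
  diff (group_complex R G) n (pullback_cochain F).
Proof.
apply/funext => g; rewrite /pullback_cochain /= /gdiff.
apply: eq_bigr => j _; congr (_ * F _); apply/funext => k.
by rewrite /face /=; do 2?case: ifP => // _; rewrite gmulfM.
Qed.

Definition pullback_map : chain_map (group_complex R H) (group_complex R G) :=
  @ChainMap R (group_complex R H) (group_complex R G)
    (fun n => @pullback_cochain n) pullback_diff.

Definition pullback n : {linear gH R H n -> gH R G n} :=
  cohomology_map pullback_map n.
End Pullback.

Section Quasimorphisms.
Variables (R : realType) (G : groupType).

Definition quasimorphism (f : G -> R) :=
  exists D : R, forall x y, `|f (x * y)%g - f x - f y| <= D.

Definition expgz (x : G) (n : int) : G :=
  match n with Posz k => (x ^+ k)%g | Negz k => (x ^- k.+1)%g end.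

Definition homogeneous (f : G -> R) :=
  forall x (n : int), f (expgz x n) = n%:~R * f x.

(* Q(G) *)
Definition hqm : {pred G -> R^o} :=
  [pred f | `[< quasimorphism f /\ homogeneous f >]].

Lemma hqmP (f : G -> R^o) :
  reflect (quasimorphism f /\ homogeneous f) (f \in hqm).
Proof. exact: asboolP. Qed.

Lemma hqm_submod : submod_closed hqm.
Proof.
split=> [|a f h].
  apply/hqmP; split=> [|x n]; last by rewrite mulr0.
  by exists 0 => x y; rewrite !subr0 normr0.
move=> /hqmP[[D hD] hf] /hqmP[[D' hD'] hh].
apply/hqmP; split.
  exists (`|a| * D + D') => x y.
  have -> : (a *: f + h) (x * y)%g - (a *: f + h) x - (a *: f + h) y =
    a * (f (x * y)%g - f x - f y) + (h (x * y)%g - h x - h y) :> R.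
    by rewrite !fctE /GRing.scale /=; ring.
  by rewrite (le_trans (ler_normD _ _)) // lerD // normrM ler_wpM2l.
move=> x n; transitivity (a * f (expgz x n) + h (expgz x n) : R) => //.
by rewrite hf hh mulrCA -mulrDr.
Qed.
HB.instance Definition _ :=
  GRing.isSubmodClosed.Build R (G -> R^o) hqm hqm_submod.
End Quasimorphisms.

Section GroupHom.
Variables (G H : groupType) (f : {multiplicative G -> H}).

Lemma ghom1 : f 1%g = 1%g.
Proof. by apply: (mulgI (f 1%g)); rewrite -gmulfM !mulg1. Qed.

Lemma ghomV x : f x^-1%g = (f x)^-1%g.
Proof. by apply: (mulgI (f x)); rewrite -gmulfM !mulgV ghom1. Qed.
End GroupHom.

Section Extension.
Variables (R : realType) (N G : groupType) (i : {multiplicative N -> G}).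

(* G-invariance of a function on N, N being embedded in G by i *)
Definition ginvariant (f : N -> R) :=
  forall (g : G) (x y : N), i y = (g * i x * g^-1)%g -> f y = f x.

Definition invariant_hqm : {pred N -> R^o} :=
  [pred f | (f \in @hqm R N) && `[< ginvariant f >]].

Lemma invariant_hqmP (f : N -> R^o) :
  reflect (f \in @hqm R N /\ ginvariant f) (f \in invariant_hqm).
Proof. by apply: (iffP andP) => -[? /asboolP]. Qed.

Lemma invariant_hqm_submod : submod_closed invariant_hqm.
Proof.
split=> [|a f h]; first by apply/invariant_hqmP; rewrite rpred0.
move=> /invariant_hqmP[Qf If] /invariant_hqmP[Qh Ih].
apply/invariant_hqmP; split; first by rewrite rpredD ?rpredZ.
move=> g x y e; transitivity (a * f y + h y : R) => //.
by rewrite (If _ _ _ e) (Ih _ _ _ e).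
Qed.
HB.instance Definition _ := GRing.isSubmodClosed.Build R (N -> R^o)
  invariant_hqm invariant_hqm_submod.

(* Q(N)^G *)
Definition QNG : lmodType R := submod invariant_hqm.

(* H^1(N)^G and i^* Q(G), as subspaces of Q(N)^G *)
Definition invariant_hom : {pred QNG} :=
  [pred f : QNG | `[< {morph (val f : N -> R) : x y / (x * y)%g >-> x + y} >]].

Definition restr_hqm : {pred QNG} :=
  [pred f : QNG | `[< exists2 q : G -> R^o, q \in @hqm R G & val f = q \o i >]].

Lemma invariant_homP (f : QNG) :
  reflect {morph (val f : N -> R) : x y / (x * y)%g >-> x + y}
    (f \in invariant_hom).
Proof. exact: asboolP. Qed.

Lemma restr_hqmP (f : QNG) :
  reflect (exists2 q : G -> R^o, q \in @hqm R G & val f = q \o i)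
    (f \in restr_hqm).
Proof. exact: asboolP. Qed.

Lemma invariant_hom_submod : submod_closed invariant_hom.
Proof.
split=> [|a f h /invariant_homP Hf /invariant_homP Hh]; apply/invariant_homP.
  by move=> x y; rewrite addr0.
move=> x y; rewrite /= !fctE Hf Hh /= /GRing.scale /=; ring.
Qed.
HB.instance Definition _ := GRing.isSubmodClosed.Build R QNG
  invariant_hom invariant_hom_submod.

Lemma restr_hqm_submod : submod_closed restr_hqm.
Proof.
split=> [|a f h /restr_hqmP[q Qq Ef] /restr_hqmP[r Qr Eh]]; apply/restr_hqmP.
  by exists 0; rewrite ?rpred0.
by exists (a *: q + r); rewrite ?rpredD ?rpredZ //= Ef Eh.
Qed.
HB.instance Definition _ := GRing.isSubmodClosed.Build R QNG
  restr_hqm restr_hqm_submod.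

Definition hom_plus_restr : submodClosed QNG :=
  subspace_sum invariant_hom restr_hqm.

Variables (H : groupType) (p : {multiplicative G -> H}).

Definition short_exact :=
  [/\ injective i, forall h, exists g, p g = h &
      forall g, p g = 1%g <-> exists n, i n = g].

(* The extensions F of f used to define tau_{/b} *)
Definition quasi_extension (f : N -> R) (F : G -> R) :=
  (forall x, F (i x) = f x) /\
  exists D : R, forall g n,
    `|F (i n * g)%g - F (i n) - F g| <= D /\
    `|F (g * i n)%g - F g - F (i n)| <= D.

(* (a, b) |-> delta F (s a, s b) *)
Definition taub_cochain (F : G -> R) (s : H -> G) : gcochain R H 2 :=
  fun c => let x := s (c ord0) in let y := s (c ord_max) in
    F y - F (x * y)%g + F x.

Definition is_taub (f : QNG) (c : gHmodb R H 2) :=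
  exists (F : G -> R) (s : H -> G) (z : submod (@cocycle R (modb_complex R H) 2)),
    [/\ quasi_extension (val f) F, cancel s p,
        val z = qpi (@bounded_cochains R H 2) (taub_cochain F s)
      & c = cohom_class z].

Definition taub (f : QNG) : gHmodb R H 2 := xget 0 [set c | is_taub f c]%classic.
Hypothesis ex : short_exact.

Let inj_i : injective i. Proof. by case: ex. Qed.

Lemma section_ex : exists s : H -> G, cancel s p.
Proof. by case: ex => _ sp _; have [s sK] := choice sp; exists s. Qed.

Lemma fiberP g h : p g = p h -> exists n, g = (i n * h)%g.
Proof.
case: ex => _ _ ker e; have [|n nE] := (ker (g * h^-1)%g).1 _.
  by rewrite gmulfM ghomV e mulgV.
by exists n; rewrite nE mulgVK.
Qed.

Lemma conjP g n : exists k, i k = (g * i n * g^-1)%g.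
Proof.
case: ex => _ _ ker; apply/ker; rewrite !gmulfM ghomV.
by rewrite (ker (i n)).2 ?mulg1 ?mulgV //; exists n.
Qed.

Lemma quasi_extension_ex (f : QNG) : exists F, quasi_extension (val f) F.
Proof.
have /invariant_hqmP[/hqmP[[D hD] _] If] := valP f.
have [s sK] := section_ex.
pose t h := if h == 1%g then 1%g else s h.
have tK : cancel t p.
  by move=> h; rewrite /t; case: eqP => [->|_]; rewrite ?ghom1 ?sK.
have /choice[c cE] g : exists n, g = (i n * t (p g))%g.
  by apply: fiberP; rewrite tK.
have c_uniq g n : g = (i n * t (p g))%g -> c g = n.
  by move=> e; apply: inj_i; apply: (mulIg (t (p g))); rewrite -cE.
have ip n : p (i n) = 1%g by case: ex => _ _ ker; apply/ker; exists n.
have ci n : c (i n) = n by apply: c_uniq; rewrite ip /t eqxx mulg1.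
have cl n g : c (i n * g)%g = (n * c g)%g.
  by apply: c_uniq; rewrite !gmulfM ip mul1g -mulgA -cE.
exists (fun g => val f (c g)); split=> [x|]; first by rewrite ci.
exists D => g n; rewrite ci cl; split=> //.
have [k kE] := conjP (t (p g)) n.
rewrite (c_uniq (g * i n)%g (c g * k)%g); first by rewrite -(If _ _ _ kE).
by rewrite !gmulfM ip mulg1 kE [in LHS](cE g) !mulgA mulgVK.
Qed.

Lemma taub_cochain_cocycle (f : QNG) F s :
  quasi_extension (val f) F -> cancel s p ->
  qpi (@bounded_cochains R H 2) (taub_cochain F s) \in
    @cocycle R (modb_complex R H) 2.
Proof.
move=> [Ff [D hF]] sK; have /invariant_hqmP[_ If] := valP f.
apply: (introT (cocycleP (_ : modb_complex R H 2))); rewrite /= quotmod_mapE; apply/qpi_eq0/bounded_cochainsP.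
exists (4 * D) => c.
rewrite [X in `|X|](gdiff2E (fun x y => F (s y) - F (s x * s y)%g + F (s x)) c).
move: (c _) (c _) (c _) => x y z.
have [n1 e1] : exists n, (s y * s z = i n * s (y * z))%g.
  by apply: fiberP; rewrite gmulfM !sK.
have [n2 e2] : exists n, (s x * s y = i n * s (x * y))%g.
  by apply: fiberP; rewrite gmulfM !sK.
have [k kE] := conjP (s x) n1.
have e3 : (i n2 * (s (x * y) * s z) = i k * (s x * s (y * z)))%g.
  by rewrite mulgA -e2 kE !mulgA mulgVK -!mulgA e1.
have [+ _] := hF (s (y * z)%g) n1; have [+ _] := hF (s (x * y)%g) n2.
have [+ _] := hF (s (x * y)%g * s z)%g n2.
have [+ _] := hF (s x * s (y * z)%g)%g k.
rewrite e3 -e1 -e2 !Ff (If _ _ _ kE) !ler_norml.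
move=> /andP[? ?] /andP[? ?] /andP[? ?] /andP[? ?]; apply/andP; split; lra.
Qed.

Lemma is_taub_ex (f : QNG) : exists c, is_taub f c.
Proof.
have [F hF] := quasi_extension_ex f; have [s sK] := section_ex.
pose z := Submod (taub_cochain_cocycle hF sK).
by exists (cohom_class z), F, s, z.
Qed.

Lemma is_taub_uniq (f : QNG) c c' : is_taub f c -> is_taub f c' -> c = c'.
Proof.
have /invariant_hqmP[/hqmP[[D0 hD0] _] If] := valP f.
move=> [F [s [z [[Ff [D hF]] sK zE ->]]]].
move=> [F' [s' [z' [[Ff' [D' hF']] sK' zE' ->]]]].
apply/cohom_class_eq; rewrite zE zE'.
have /choice[m mE] h : exists n, s' h = (i n * s h)%g.
  by apply: fiberP; rewrite sK sK'.
pose t h : R := F (s h) - F' (s' h) + val f (m h).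
exists (qpi (@bounded_cochains R H 1) (fun g => t (g ord0))).
rewrite /= quotmod_mapE -linearB; apply/qpi_eq/bounded_cochainsP.
exists (D + D' + 3 * D0) => u.
have -> : (taub_cochain F s - taub_cochain F' s' -
    gdiff (fun g : 'I_1 -> H => t (g ord0) : R^o)) u =
  taub_cochain F s u - taub_cochain F' s' u -
    (t (u ord_max) - t (u ord0 * u ord_max)%g + t (u ord0)) :> R.
  by rewrite -(gdiff1E t u).
rewrite /taub_cochain /t; move: (u _) (u _) => x y.
have [n e1] : exists n, (s x * s y = i n * s (x * y))%g.
  by apply: fiberP; rewrite gmulfM !sK.
have [n' e2] : exists n, (s' x * s' y = i n * s' (x * y))%g.
  by apply: fiberP; rewrite gmulfM !sK'.
have [k kE] := conjP (s x) (m y).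
have e3 : (n' * m (x * y) = m x * k * n)%g.
  apply: inj_i; apply: (mulIg (s (x * y)%g)); rewrite !gmulfM kE.
  rewrite -[LHS]mulgA -mE -e2 -[RHS]mulgA -e1 (mE x) (mE y) !mulgA.
  by rewrite mulgVK.
have [+ _] := hF (s (x * y)%g) n; have [+ _] := hF' (s' (x * y)%g) n'.
have := hD0 n' (m (x * y)%g); have := hD0 (m x * k)%g n; have := hD0 (m x) k.
rewrite -e1 -e2 -e3 Ff Ff' (If _ _ _ kE) !ler_norml.
move=> /andP[a1 a2] /andP[b1 b2] /andP[c1 c2] /andP[d1 d2] /andP[f1 f2].
by apply/andP; clear -a1 a2 b1 b2 c1 c2 d1 d2 f1 f2; split; lra.
Qed.

Lemma is_taubP f c : is_taub f c <-> taub f = c.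
Proof.
have [d fd] := is_taub_ex f.
have h : is_taub f (taub f) by rewrite /taub; case: xgetP => // /(_ d).
by split=> [|<- //]; apply: is_taub_uniq.
Qed.

Definition im_pullback_comparison : submodClosed (gH R G 2) :=
  subspace_cap (lin_im (pullback R p 2)) (lin_im (comparison R G 2)).
End Extension.
Arguments hom_plus_restr R {N G} i.
Arguments im_pullback_comparison R {G H} p.

(* Main.v *)
(** Everything is read off the equivalence [xi4_eq_taub]: a 2-cocycle z of Gamma
    satisfies [xi4 [z] = taub f] iff the pullback of z to G differs by a bounded
    cochain from the coboundary of some F : G -> R whose restriction to N is at
    bounded distance from f.  Hence [p^* [z]] is always bounded.  It vanishes iff
    [p^* z = delta w] exactly; then F - w is a quasimorphism of G, w restricts on
    N to an invariant homomorphism up to a constant, and f is the sum of that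
    homomorphism and of the homogenization of F - w.  Conversely, if [p^* z] is
    within bounded distance of [delta w], then homogenizing w on N yields an
    invariant f mapped to [p^* [z]].  The dimension bound holds because the image
    of a basis under an injective linear map extends to a basis. *)
Require Import Defs.
From HB Require Import structures.
From mathcomp Require Import all_boot all_order all_algebra.
From mathcomp Require Import ring lra.
From mathcomp Require Import boolp classical_sets functions cardinality reals.

Set Implicit Arguments.
Unset Strict Implicit.
Unset Printing Implicit Defensive.

Import Order.TTheory GRing.Theory Num.Theory.
Local Open Scope ring_scope.

(** * Linear algebra: isomorphism theorem, bases and dimension *)

Lemma first_isomorphism (R : pzRingType) (U V : lmodType R)
    (f : {linear U -> V}) (S : submodClosed U) (T : submodClosed V) :
  (forall x, x \in S <-> f x = 0) ->
  (forall y, y \in T <-> exists x, f x = y) ->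
  exists Phi : {linear quotmod S -> submod T},
    bijective Phi /\ forall x, submod_val (Phi (qpi S x)) = f x.
Proof.
move=> Sker Tim.
have fT x : f x \in T by apply/Tim; exists x.
pose phi (q : quotmod S) : submod T :=
  Submod (fT (repr (q : Quotient.quot (zmodS S)))).
have phiE x : submod_val (phi (qpi S x)) = f x.
  apply/eqP; rewrite -subr_eq0 -linearB; apply/eqP; apply: (Sker _).1.
  by apply/qpi_eq; rewrite /qpi reprK.
have phi_linear : linear phi.
  move=> a q r; have [x ->] := qpiP q; have [y ->] := qpiP r.
  apply: val_inj; rewrite -qpi_linear [RHS]linearP.
  by apply: etrans (phiE _) _; rewrite linearP -!phiE.
pose Phi : {linear quotmod S -> submod T} :=
  HB.pack phi (GRing.isLinear.Build R _ _ _ phi phi_linear).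
exists Phi; split=> //.
have phi_inj : injective phi.
  move=> q r; have [x ->] := qpiP q; have [y ->] := qpiP r.
  move=> /(congr1 (@submod_val _ _ _)); rewrite !phiE => e.
  by apply/qpi_eq/Sker; rewrite linearB e subrr.
have /choice[g gK] (y : submod T) : exists q, phi q = y.
  have /Tim[x xE] := valP y; exists (qpi S x).
  by apply: submod_eq; rewrite phiE xE.
by exists g => // q; apply: phi_inj; rewrite gK.
Qed.

Section Bases.
Variables (K : fieldType) (V : lmodType K).

(** A relation with a nonzero coefficient at [x] can be solved for [x]; this is where the scalars
    must form a field. *)
Lemma lin_indep_extend (B : set V) (x : V) :
  lin_indep B ->
  (forall s a, (forall v, v \in s -> B v) -> x <> \sum_(v <- s) a v *: v) ->
  lin_indep (x |` B)%classic.
Proof.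
move=> Bfree xB s a us sB s0.
have sB' v : v \in s -> v != x -> B v.
  by move=> /sB[-> /eqP|].
have [xs|xs] := boolP (x \in s); last first.
  by apply: Bfree us _ s0 => v vs; apply: sB' => //; apply: contraNneq xs => <-.
have remB v : v \in rem x s -> B v.
  by rewrite mem_rem_uniq // !inE => /andP[vx /sB']; apply.
move: s0; rewrite (perm_big _ (perm_to_rem xs)) big_cons /=.
have [ax0|ax0] := eqVneq (a x) 0.
  rewrite ax0 scale0r add0r => s0 v vs; have [->//|vx] := eqVneq v x.
  by apply: Bfree remB s0 _ _; rewrite ?rem_uniq // mem_rem_uniq // !inE vx.
move=> /eqP; rewrite addr_eq0 => /eqP s0; exfalso.
apply: (xB (rem x s) (fun v => - ((a x)^-1 * a v)) remB).
rewrite -[LHS]scale1r -(mulVf ax0) -scalerA s0 scalerN scaler_sumr -sumrN.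
by apply: eq_bigr => v _; rewrite scaleNr scalerA.
Qed.

(** Zorn's lemma is applied to the sets [A] with [A] union [B] independent, not to the supersets of
    [B], because the union of the empty chain is empty. *)
Lemma lin_indep_basis (B : set V) :
  lin_indep B -> exists2 C, basis C & (B `<=` C)%classic.
Proof.
move=> Bfree.
have [F FP Ftot|A [Afree Amax]] :=
    @Zorn_bigcup V [set A | lin_indep (A `|` B)]%classic.
  (* A relation involves finitely many vectors, so one member of the chain accounts for all of them;
     [set0] serves when none of them comes from the chain. *)
  move=> s a us sF; suff [X XF sX] : exists2 X, X = set0 \/ F X &
      forall v, v \in s -> (X `|` B)%classic v.
    by case: XF sX => [->|/FP Xfree] sX; [rewrite set0U in sX; apply: Bfree|apply: Xfree].
  elim: s sF {us} => [|x s IHs] sF; first by exists set0; [left|].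
  have [v vs|X XF sX] := IHs; first by apply: sF; rewrite inE vs orbT.
  have [[Y FY Yx]|Bx] := sF x (mem_head _ _); last first.
    by exists X => // v; rewrite inE => /predU1P[->|/sX//]; right.
  have [Z FZ [XZ YZ]] : exists2 Z, F Z & (X `<=` Z /\ Y `<=` Z)%classic.
    case: XF => [->|FX]; first by exists Y => //; split=> //; exact: sub0set.
    by have [XY|YX] := Ftot _ _ FX FY; [exists Y|exists X] => //; split=> // ?.
  exists Z; first by right.
  move=> v; rewrite inE => /predU1P[->|/sX[/XZ|]]; [left|left|right] => //.
  exact: YZ.
exists (A `|` B)%classic; last by move=> x; right.
split=> // x; apply: contrapT => xspan.
have {}xspan s a : (forall v, v \in s -> (A `|` B)%classic v) ->
    x <> \sum_(v <- s) a v *: v.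
  by move=> sA xE; apply: xspan; exists s, a.
have Ax : ~ A x.
  move=> Ax; apply: (xspan [:: x] (fun=> 1)).
    by move=> v; rewrite inE => /eqP ->; left.
  by rewrite big_seq1 scale1r.
apply: (Amax (x |` A)%classic); last first.
  by rewrite /= -setUA; apply: lin_indep_extend.
by split=> [v|/(_ x (or_introl erefl))//]; right.
Qed.
End Bases.

Lemma lin_indep_image (R : pzRingType) (V W : lmodType R)
    (f : {linear V -> W}) (B : set V) :
  injective f -> lin_indep B -> lin_indep (f @` B)%classic.
Proof.
move=> f_inj Bfree s a us sB.
have [t [ut tB ->]] : exists t, [/\ uniq t, forall v, v \in t -> B v & s = map f t].
  elim: s us sB => [|w s IHs] /=; first by exists [::].
  move=> /andP[ws us] sB; have [v vs|t [ut tB sE]] := IHs us.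
    by apply: sB; rewrite inE vs orbT.
  have [v Bv vw] := sB w (mem_head _ _); exists (v :: t); split.
  - by rewrite /= ut andbT; apply: contra ws => vt; rewrite -vw sE map_f.
  - by move=> u; rewrite inE => /predU1P[->|/tB].
  - by rewrite /= vw sE.
rewrite big_map => s0 _ /mapP[v vt ->].
apply: (Bfree t (a \o f)) => //; apply: f_inj; rewrite linear0 -[RHS]s0.
by rewrite linear_sum; apply: eq_bigr => u _; rewrite linearZ.
Qed.

Lemma injective_dim_le (K : fieldType) (V W : lmodType K)
    (f : {linear V -> W}) : injective f -> dim_le V W.
Proof.
move=> f_inj.
have [|B [Bfree Bspan] _] := @lin_indep_basis K V set0.
  by move=> [//|x s] a _ /(_ x (mem_head _ _)).
have [C Cbasis BC] := lin_indep_basis (lin_indep_image f_inj Bfree).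
exists B, C; split=> //; apply: card_le_trans (subset_card_le BC).
by have /card_eqPle[] := inj_card_eq (in2W f_inj : {in B &, injective f}).
Qed.

(** * Homogenization of quasimorphisms *)

Section Homogenization.
Variable R : realType.

Lemma bounded_multiples_eq0 (x D : R) : (forall n, `|n%:R * x| <= D) -> x = 0.
Proof.
move=> xD; apply/eqP/negP => /negP x0.
have := xD (Num.truncn (D / `|x|)).+1; apply/negP; rewrite -ltNge.
by rewrite normrM normr_nat -ltr_pdivrMr ?normr_gt0 // truncnS_gt.
Qed.

(* [r] is the infimum of [(a n + D) / n], which lies above every
   [(a m - D) / m]: compare both with [a (m * n) / (m * n)]. *)
Lemma quasiadditive_linear (a : nat -> R) (D : R) :
  (forall m n, `|a (m + n)%N - a m - a n| <= D) ->
  exists r, forall n, `|a n - n%:R * r| <= D.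
Proof.
move=> aD.
have aM k n : `|a (k.+1 * n)%N - k.+1%:R * a n| <= k%:R * D.
  elim: k => [|k IHk]; first by rewrite mul1n mul1r subrr normr0 mul0r.
  rewrite mulSn; have := aD n (k.+1 * n)%N; move: IHk; rewrite !ler_norml.
  by rewrite -!natr1 !mulrDl => /andP[? ?] /andP[? ?]; apply/andP; split; lra.
have D0 : 0 <= D by apply: le_trans (aD 0%N 0%N).
have cmp m n : (a m.+1 - D) / m.+1%:R <= (a n.+1 + D) / n.+1%:R.
  rewrite ler_pdivrMr ?ltr0n // mulrAC ler_pdivlMr ?ltr0n //.
  have := aM m n.+1; have := aM n m.+1; rewrite mulnC !ler_norml.
  rewrite -!natr1 => /andP[+ _] /andP[_ +].
  by set M := m%:R; set N := n%:R; lra.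
pose E := [set (a n.+1 + D) / n.+1%:R | n in [set: nat]]%classic.
exists (inf E) => -[|n].
  (* The quotients leave out index 0, where the claim is the defect bound at (0, 0). *)
  by rewrite mul0r subr0; have := aD 0%N 0%N; rewrite addn0 subrr sub0r normrN.
have lo : (a n.+1 - D) / n.+1%:R <= inf E.
  apply: lb_le_inf; first by exists ((a 1%N + D) / 1%:R), 0%N.
  by move=> _ [m _ <-].
have hi : inf E <= (a n.+1 + D) / n.+1%:R.
  apply: ge_inf; last by exists n.
  by exists ((a 1%N - D) / 1%:R) => _ [m _ <-].
move: lo hi; rewrite ler_pdivrMr ?ltr0n // ler_pdivlMr ?ltr0n // ler_norml.
by rewrite mulrC => ? ?; apply/andP; split; lra.
Qed.

Variable G : groupType.
Implicit Types (f q : G -> R) (x : G).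

Lemma homogeneousX f x n : homogeneous f -> f (x ^+ n)%g = n%:R * f x.
Proof. by move=> /(_ x (Posz n)). Qed.

Lemma homogeneous_bounded_eq f q D :
  homogeneous f -> homogeneous q -> (forall x, `|f x - q x| <= D) -> f =1 q.
Proof.
move=> fH qH fq x; apply/eqP; rewrite -subr_eq0; apply/eqP.
apply: (bounded_multiples_eq0 (D := D)) => n.
by rewrite mulrBr -!homogeneousX.
Qed.

Lemma quasimorphism_bounded_diff f q D :
  quasimorphism f -> (forall x, `|q x - f x| <= D) -> quasimorphism q.
Proof.
move=> [C fC] qf; exists (C + 3 * D) => x y.
have := fC x y; have := qf (x * y)%g; have := qf x; have := qf y.
by rewrite !ler_norml => /andP[? ?] /andP[? ?] /andP[? ?] /andP[? ?];
  apply/andP; split; lra.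
Qed.

(** The value [q x] is the slope of n |-> f(x^n), which is known up to an error [D] uniform in [x];
    no limit is taken. *)
Lemma homogenization f : quasimorphism f ->
  exists2 q : G -> R^o, q \in @hqm R G & exists D, forall x, `|q x - f x| <= D.
Proof.
move=> fqm; have [D fD] := fqm.
have /choice[q qD] x : exists r, forall n, `|f (x ^+ n)%g - n%:R * r| <= D.
  by apply: quasiadditive_linear => m n; rewrite expgnDr.
(* A slope is determined by any bounded error, so homogeneity reduces to exhibiting slopes along the
   powers of x^k and x^-1. *)
have q_uniq x r C : (forall n, `|f (x ^+ n)%g - n%:R * r| <= C) -> q x = r.
  move=> rC; apply/eqP; rewrite -subr_eq0; apply/eqP.
  apply: (bounded_multiples_eq0 (D := C + D)) => n.
  have := rC n; have := qD x n; rewrite mulrBr !ler_norml.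
  by move=> /andP[? ?] /andP[? ?]; apply/andP; split; lra.
have qX x k : q (x ^+ k)%g = k%:R * q x.
  apply: (q_uniq _ _ D) => n; have := qD x (k * n)%N.
  by rewrite expgnA natrM mulrCA mulrA.
have qV x : q x^-1%g = - q x.
  (* One [D] each for the slope at [x], the defect at (x^n, x^-n), and |f(1)|. *)
  apply: (q_uniq _ _ (3 * D)) => n; rewrite expVgn.
  have := fD (x ^+ n)%g (x ^- n)%g; rewrite mulgV.
  have := qD x n; have := fD 1%g 1%g; rewrite mulg1 !ler_norml.
  move=> /andP[? ?] /andP[? ?] /andP[? ?].
  by rewrite mulrN; apply/andP; split; lra.
have qf x : `|q x - f x| <= D.
  by have := qD x 1%N; rewrite expg1 mul1r distrC.
exists q; last by exists D.
apply/hqmP; split; first exact: quasimorphism_bounded_diff fqm qf.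
by move=> x [n|n]; rewrite /expgz ?qV qX // NegzE mulrNz mulNr.
Qed.
End Homogenization.

(** * Degree-2 classes in terms of functions of two variables *)

Section TwoCocycles.
Variables (R : realType) (G : groupType).
Implicit Types (z : G -> G -> R) (F w : G -> R) (c : gH R G 2).

Definition cochain1 F : gcochain R G 1 := fun g => F (g ord0).

Definition cochain2 z : gcochain R G 2 := fun g => z (g ord0) (g ord_max).

Definition delta1 F (x y : G) : R := F y - F (x * y)%g + F x.

Definition cocycle2 z := forall x y t,
  z y t - z (x * y)%g t + z x (y * t)%g - z x y = 0.

(** Keeping the cocycle proof inside an existential lets [z] be handled as a plain function. *)
Definition represents z c :=
  exists Z : submod (@cocycle R (group_complex R G) 2),
    c = cohom_class Z /\ val Z = cochain2 z.

Definition pair2 (x y : G) : 'I_2 -> G := fun k => if k == ord0 then x else y.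

Lemma cochain2_pair2 z x y : cochain2 z (pair2 x y) = z x y.
Proof. by []. Qed.

Lemma pair2_surj (g : 'I_2 -> G) : g = pair2 (g ord0) (g ord_max).
Proof.
apply/funext => k; rewrite /pair2; case: eqP => [->//|k0]; congr g.
by apply: val_inj; case: k k0 => [[|[|m]] km] // k0; case: k0; apply: val_inj.
Qed.

Lemma cochain2_surj (C : gcochain R G 2) : exists z, C = cochain2 z.
Proof.
exists (fun x y => C (pair2 x y)); apply/funext => g.
by rewrite /cochain2 -pair2_surj.
Qed.

Lemma cochain1_surj (C : gcochain R G 1) : exists F, C = cochain1 F.
Proof.
exists (fun x => C (fun=> x)); apply/funext => g; congr C.
by apply/funext => k; congr g; apply: val_inj; case: k => [[]].
Qed.

Lemma gdiff_cochain1 F : gdiff (cochain1 F) = cochain2 (delta1 F).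
Proof. by apply/funext => g; apply: gdiff1E. Qed.

Lemma gdiff_cochain2 z : gdiff (cochain2 z) = 0 <-> cocycle2 z.
Proof.
split=> [dz x y t|zz]; last first.
  by apply/funext => g; rewrite [LHS](gdiff2E z) zz.
pose g : 'I_3 -> G := fun k =>
  if val k == 0%N then x else if val k == 1%N then y else t.
by have := gdiff2E z g; rewrite /= => <-; rewrite -[LHS]/(gdiff (cochain2 z) g) dz.
Qed.

Lemma represents_ex c : exists z, represents z c.
Proof.
have [Z ->] := cohom_classP c; have [z zE] := cochain2_surj (val Z).
by exists z, Z.
Qed.

Lemma represents_cocycle z c : represents z c -> cocycle2 z.
Proof.
move=> [Z [_ ZE]]; apply/gdiff_cochain2; rewrite -ZE.
exact: elimT (cocycleP _) (valP Z).
Qed.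

Lemma cocycle_represents z : cocycle2 z -> exists c, represents z c.
Proof.
move=> /gdiff_cochain2 zz.
have zz' : (cochain2 z : group_complex R G 2) \in
    @cocycle R (group_complex R G) 2 by apply/cocycleP.
by exists (cohom_class (Submod zz')), (Submod zz').
Qed.

Lemma represents_eq0 z c : represents z c ->
  c = 0 <-> exists w, z =2 delta1 w.
Proof.
move=> [Z [-> ZE]]; rewrite cohom_class_eq0 ZE; split=> [[C]|[w zw]].
  have [w ->] := cochain1_surj C; rewrite [diff _ _ _]gdiff_cochain1 => zw.
  by exists w => x y; rewrite -cochain2_pair2 zw.
exists (cochain1 w); rewrite [diff _ _ _]gdiff_cochain1.
by apply/funext => g; apply: zw.
Qed.

Lemma represents_comparison z c : represents z c ->
  c \in lin_im (comparison R G 2) <->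
  exists w D, forall x y, `|z x y - delta1 w x y| <= D.
Proof.
move=> [Z [-> ZE]]; split.
  move=> /lin_imP[b]; have [B ->] := cohom_classP b.
  rewrite cohomology_mapE => /cohom_class_eq[C].
  have /bounded_cochainsP[D BD] := valP (val B).
  rewrite ZE; have [w ->] := cochain1_surj C.
  rewrite [diff _ _ _]gdiff_cochain1 => zw.
  (* The sign changes because the equality of classes reads b - z = delta w with b bounded. *)
  exists (- w), D => x y; have := BD (pair2 x y); congr (`|_| <= _).
  have zwxy : (val (val B) : _ -> R) (pair2 x y) - z x y = delta1 w x y.
    exact: (congr1 (fun f : gcochain R G 2 => f (pair2 x y)) zw).
  by move: zwxy; rewrite /delta1 !fctE; lra.
move=> [w [D zD]]; apply/lin_imP.
have Bb : cochain2 (fun x y => z x y - delta1 w x y) \in @bounded_cochains R G 2.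
  by apply/bounded_cochainsP; exists D => g; apply: zD.
have zB : (Submod Bb : bounded_complex R G 2) \in
    @cocycle R (bounded_complex R G) 2.
  apply/cocycleP; apply: submod_eq => /=.
  transitivity (gdiff (cochain2 z - cochain2 (delta1 w))); first by [].
  rewrite (linearB (@gdiff R G 2)) /= -gdiff_cochain1 gdiffK subr0 -ZE.
  exact: elimT (cocycleP _) (valP Z).
exists (cohom_class (Submod zB)); rewrite cohomology_mapE.
apply/cohom_class_eq; exists (cochain1 (- w)).
rewrite [diff _ _ _]gdiff_cochain1 ZE; apply/funext => g.
transitivity (z (g ord0) (g ord_max) - delta1 w (g ord0) (g ord_max) -
  z (g ord0) (g ord_max) : R); first by [].
by rewrite /cochain2 /delta1 !fctE; ring.
Qed.

(** The function [t] need not be a cocycle: the cochains defining tau_{/b} are cocycles only modulo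
    bounded ones. *)
Lemma represents_xi4 z c t (Z : submod (@cocycle R (modb_complex R G) 2)) :
  represents z c -> val Z = qpi (@bounded_cochains R G 2) (cochain2 t) ->
  xi4 R G c = cohom_class Z <->
  exists w D, forall x y, `|z x y - t x y - delta1 w x y| <= D.
Proof.
move=> [Y [-> YE]] ZE; rewrite /xi4 /to_modb cohomology_mapE.
rewrite cohom_class_eq ZE /= -[submod_val Y]/(val Y) YE; split.
  move=> [C]; have [B ->] := qpiP C; have [w ->] := cochain1_surj B.
  rewrite /= quotmod_mapE /= gdiff_cochain1 -linearB.
  move=> /qpi_eq/bounded_cochainsP[D zD].
  by exists w, D => x y; have := zD (pair2 x y).
move=> [w [D zD]]; exists (qpi (@bounded_cochains R G 1) (cochain1 w)).
rewrite /= quotmod_mapE /= gdiff_cochain1 -linearB.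
by apply/qpi_eq/bounded_cochainsP; exists D => g; apply: zD.
Qed.
End TwoCocycles.

(** * Compatibility with homomorphisms, and cocycles at the identity *)

Lemma represents_pullback (R : realType) (G H : groupType)
    (p : {multiplicative G -> H}) (z : H -> H -> R) (c : gH R H 2) :
  represents z c -> represents (fun x y => z (p x) (p y)) (pullback R p 2 c).
Proof.
move=> [Z [-> ZE]]; rewrite /pullback cohomology_mapE.
by eexists; split; first reflexivity; rewrite /= -[submod_val Z]/(val Z) ZE.
Qed.

Lemma ghomX (G H : groupType) (f : {multiplicative G -> H}) x n :
  f (x ^+ n)%g = (f x ^+ n)%g.
Proof. by elim: n => [|n IHn]; rewrite ?ghom1 // !expgS gmulfM IHn. Qed.

Lemma ghom_expgz (G H : groupType) (f : {multiplicative G -> H}) x n :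
  f (expgz x n) = expgz (f x) n.
Proof. by case: n => n; rewrite /expgz ?ghomV ghomX. Qed.

Section Cocycle2Normal.
Variables (R : realType) (G : groupType) (z : G -> G -> R).
Hypothesis zz : cocycle2 z.

(** A cocycle pulled back along [p] sees an element of N as 1, hence is constant once an argument
    lies in N; this is the source of [z 1 1] in the formulas below. *)
Lemma cocycle2_1l x : z 1%g x = z 1%g 1%g.
Proof. by have := zz 1%g 1%g x; rewrite !mul1g; lra. Qed.

Lemma cocycle2_1r x : z x 1%g = z 1%g 1%g.
Proof. by have := zz x 1%g 1%g; rewrite !mulg1; lra. Qed.
End Cocycle2Normal.

(** * The map tau_{/b} read off on G *)

Section ExtensionTheory.
Variables (R : realType) (N G Gamma : groupType).
Variables (i : {multiplicative N -> G}) (p : {multiplicative G -> Gamma}).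
Hypothesis ex : short_exact i p.
Implicit Types (f : QNG R i) (F : G -> R) (z : Gamma -> Gamma -> R).

Let i_inj : injective i. Proof. by case: ex. Qed.

Lemma short_exact_comp1 n : p (i n) = 1%g.
Proof. by case: ex => _ _ ker; apply/ker; exists n. Qed.

(** With a common section, a F + F' is an extension of a f + f'; independence of choices does the
    rest. *)
Lemma taub_linear : linear (@taub R N G i Gamma p).
Proof.
move=> a f f'; have [s sK] := section_ex ex.
have [F hF] := quasi_extension_ex ex f.
have [F' hF'] := quasi_extension_ex ex f'.
pose Z := Submod (taub_cochain_cocycle ex hF sK).
pose Z' := Submod (taub_cochain_cocycle ex hF' sK).
have -> : taub p f = cohom_class Z by apply/(is_taubP ex); exists F, s, Z.
have -> : taub p f' = cohom_class Z' by apply/(is_taubP ex); exists F', s, Z'.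
apply/(is_taubP ex).
exists (fun g => a * F g + F' g), s, (a *: Z + Z'); split=> //; last first.
- exact/esym/(qpi_linear _ a Z Z').
- transitivity (a *: qpi (@bounded_cochains R Gamma 2) (taub_cochain F s) +
    qpi (@bounded_cochains R Gamma 2) (taub_cochain F' s)); first by [].
  rewrite -linearP; congr qpi; apply/funext => g.
  transitivity (a * taub_cochain F s g + taub_cochain F' s g : R); first by [].
  by rewrite /taub_cochain; ring.
have [[Ff [D FD]] [Ff' [D' FD']]] := (hF, hF'); split=> [n|].
  by rewrite Ff Ff' [val (a *: f + f')]linearP.
exists (`|a| * D + D') => g n; have [Fl Fr] := FD g n; have [Fl' Fr'] := FD' g n.
split.
  have -> : a * F (i n * g)%g + F' (i n * g)%g - (a * F (i n) + F' (i n)) -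
      (a * F g + F' g) = a * (F (i n * g)%g - F (i n) - F g) +
      (F' (i n * g)%g - F' (i n) - F' g) by ring.
  by rewrite (le_trans (ler_normD _ _)) // lerD // normrM ler_wpM2l.
have -> : a * F (g * i n)%g + F' (g * i n)%g - (a * F g + F' g) -
    (a * F (i n) + F' (i n)) = a * (F (g * i n)%g - F g - F (i n)) +
    (F' (g * i n)%g - F' g - F' (i n)) by ring.
by rewrite (le_trans (ler_normD _ _)) // lerD // normrM ler_wpM2l.
Qed.

(* Writing [g = i n * g'] and [h = i m * h'], one has
   [g * h = i (n * k) * (g' * h')] where [k] is conjugate to [m]. *)
Lemma delta1_fiber (f : N -> R) F (D D' : R) :
  ginvariant i f ->
  (forall n m, `|f (n * m)%g - f n - f m| <= D') ->
  (forall n g, `|F (i n * g)%g - f n - F g| <= D) ->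
  forall g h g' h', p g = p g' -> p h = p h' ->
  `|delta1 F g h - delta1 F g' h'| <= 3 * D + D'.
Proof.
move=> fI fD FD g h g' h' /(fiberP ex)[n ->] /(fiberP ex)[m ->].
have [k kE] := conjP ex g' m.
rewrite /delta1; have -> : (i n * g' * (i m * h') = i (n * k) * (g' * h'))%g.
  by rewrite gmulfM kE !mulgA mulgVK.
(* Each of the three values of [F] costs [D] and splitting f(n k) costs [D']; the values of [f] then
   cancel since f(k) = f(m). *)
have := fI _ _ _ kE; have := fD n k.
have := FD (n * k)%g (g' * h')%g; have := FD n g'; have := FD m h'.
rewrite !ler_norml.
move=> /andP[? ?] /andP[? ?] /andP[? ?] /andP[? ?] ?.
by apply/andP; split; lra.
Qed.

Lemma xi4_eq_taub f z c : represents z c ->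
  xi4 R Gamma c = taub p f <->
  exists F D, (forall n, `|F (i n) - val f n| <= D) /\
    forall g h, `|z (p g) (p h) - delta1 F g h| <= D.
Proof.
move=> zc; have /invariant_hqmP[/hqmP[[D0 fD] _] fI] := valP f.
split.
  have [F [s [Z [[Ff [D FD]] sK ZE ->]]]] := (is_taubP ex f _).2 erefl.
  have /(represents_xi4 zc) -> : val Z =
    qpi _ (cochain2 (fun x y => delta1 F (s x) (s y))) by [].
  move=> [u [C zu]].
  have Fdelta g h :
      `|delta1 F g h - delta1 F (s (p g)) (s (p h))| <= 3 * D + D0.
    apply: (delta1_fiber fI fD); rewrite ?sK // => n g'.
    by rewrite -Ff; case: (FD g' n).
  have D0' : 0 <= 3 * D + D0 by apply: le_trans (Fdelta 1%g 1%g).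
  have C0 : 0 <= C by apply: le_trans (zu 1%g 1%g).
  (* The cochain [u] of Gamma absorbs the coboundary relating [z] to tau_{/b}(f); on N it adds the
     constant [u 1]. *)
  exists (fun g => F g + u (p g)), (C + (3 * D + D0) + `|u 1%g|); split=> [n|g h].
    by rewrite Ff short_exact_comp1 addrC addKr lerDr addr_ge0.
  have u0 := normr_ge0 (u 1%g).
  have := zu (p g) (p h); have := Fdelta g h.
  rewrite /delta1 gmulfM !ler_norml => /andP[? ?] /andP[? ?].
  by apply/andP; split; lra.
move=> [F [D [Ff Fz]]].
(* A quasi-extension must equal f on N, so [F] is corrected there, at a cost of at most [D] per
   value. *)
have /choice[F' F'E] g :
    exists y, (forall n, i n = g -> y = val f n) /\ `|y - F g| <= D.
  have [[n ng]|gN] := pselect (exists n, i n = g).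
    exists (val f n); split; last by rewrite -ng distrC.
    by move=> m; rewrite -ng => /i_inj ->.
  exists (F g); split; first by move=> n ng; case: gN; exists n.
  by rewrite subrr normr0; apply: le_trans (Ff 1%g).
have {}Fz g h : `|z (p g) (p h) - delta1 F' g h| <= 4 * D.
  have := Fz g h.
  have [_] := F'E g; have [_] := F'E h; have [_] := F'E (g * h)%g.
  rewrite /delta1 !ler_norml => /andP[? ?] /andP[? ?] /andP[? ?] /andP[? ?].
  by apply/andP; split; lra.
have F'f n : F' (i n) = val f n by apply: (F'E (i n)).1.
have zz := represents_cocycle zc.
(* With an argument in N, delta F' is the defect to be bounded, up to sign, and it is close to the
   constant [z 1 1]. *)
have F'q : quasi_extension i (val f) F'.
  split=> //; exists (4 * D + `|z 1%g 1%g|) => g n.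
  have := Fz (i n) g; have := Fz g (i n); have := ler_norm (z 1%g 1%g).
  have := ler_norm (- z 1%g 1%g); rewrite normrN.
  rewrite !short_exact_comp1 cocycle2_1l // cocycle2_1r // /delta1 !ler_norml.
  move=> ? ? /andP[? ?] /andP[? ?].
  by split; apply/andP; split; lra.
have [s sK] := section_ex ex.
pose Z := Submod (taub_cochain_cocycle ex F'q sK).
have <- : cohom_class Z = taub p f.
  by apply/esym/(is_taubP ex); exists F', s, Z.
apply: (represents_xi4 zc (t := fun x y => delta1 F' (s x) (s y)) (Z := Z) _).2 => //.
exists (fun=> 0), (4 * D) => x y.
have -> : delta1 (fun=> 0) x y = 0 :> R by rewrite /delta1 subrr addr0.
by have := Fz (s x) (s y); rewrite !sK subr0.
Qed.

Lemma left_equivariant_retraction : exists r : G -> N,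
  r 1%g = 1%g /\ forall n g, r (i n * g)%g = (n * r g)%g.
Proof.
have [s sK] := section_ex ex.
have /choice[c cE] g : exists n, g = (i n * s (p g))%g.
  by apply: (fiberP ex); rewrite sK.
have cM n g : c (i n * g)%g = (n * c g)%g.
  apply: i_inj; apply: (mulIg (s (p (i n * g)%g))); rewrite -cE.
  by rewrite !gmulfM short_exact_comp1 mul1g -mulgA -cE.
(* The section need not send 1 to 1; a right translation repairs this and keeps left
   equivariance. *)
exists (fun g => (c g * (c 1)^-1)%g); split=> [|n g]; first by rewrite mulgV.
by rewrite cM mulgA.
Qed.

(** * Kernel and image of p^* xi_4^{-1} tau_{/b} *)

Hypothesis Hac : boundedly_acyclic R Gamma 3.

Lemma xi4_inv_linear : linear (@xi4_inv R Gamma).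
Proof.
move=> a y y'; apply: (xi4_inj Hac); rewrite (xi4_invK Hac).
by rewrite [RHS](linearP (xi4 R Gamma)) !(xi4_invK Hac).
Qed.

Definition taub_pullback f : gH R G 2 := pullback R p 2 (xi4_inv (taub p f)).

Lemma taub_pullback_linear : linear taub_pullback.
Proof.
by move=> a f f'; rewrite /taub_pullback taub_linear xi4_inv_linear linearP.
Qed.

(** Computes the map without inverting xi_4: it suffices to exhibit a cocycle [z] and a function [F]
    meeting the criterion. *)
Lemma taub_pullback_eq f z c F D : represents z c ->
  (forall n, `|F (i n) - val f n| <= D) ->
  (forall g h, `|z (p g) (p h) - delta1 F g h| <= D) ->
  taub_pullback f = pullback R p 2 c.
Proof.
move=> zc Ff Fz; congr (pullback R p 2 _); rewrite -[RHS](xi4K Hac).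
by congr xi4_inv; apply/esym/(xi4_eq_taub f zc); exists F, D.
Qed.

Lemma taub_pullback_cocycle f : exists z c F D,
  [/\ represents z c, taub_pullback f = pullback R p 2 c,
      forall n, `|F (i n) - val f n| <= D &
      forall g h, `|z (p g) (p h) - delta1 F g h| <= D].
Proof.
have [z zc] := represents_ex (xi4_inv (taub p f)).
have [F [D [Ff Fz]]] := (xi4_eq_taub f zc).1 (xi4_invK Hac _).
by exists z, (xi4_inv (taub p f)), F, D.
Qed.

(* Extended by a left equivariant retraction G -> N, an invariant homomorphism
   has a coboundary that is exactly, not just up to bounded error, a pullback. *)
Lemma taub_pullback_hom f : f \in @invariant_hom R N G i -> taub_pullback f = 0.
Proof.
move=> /invariant_homP fM; have /invariant_hqmP[_ fI] := valP f.
have [r [r1 rM]] := left_equivariant_retraction; have [s sK] := section_ex ex.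
pose F g := val f (r g); pose z x y := delta1 F (s x) (s y).
have FM n g : F (i n * g)%g = val f n + F g by rewrite /F rM fM.
have zF g h : z (p g) (p h) = delta1 F g h.
  apply/esym/eqP; rewrite -subr_eq0 -normr_le0.
  (* With both defects zero, [delta1_fiber] becomes an equality. *)
  rewrite -[leRHS](_ : 3 * 0 + 0 = 0); last by rewrite mulr0 addr0.
  apply: (delta1_fiber fI); rewrite ?sK // => n g'.
    by rewrite fM -addrA -opprD subrr normr0.
  by rewrite FM -addrA -opprD subrr normr0.
have zz : cocycle2 z.
  move=> x y t; rewrite -(sK x) -(sK y) -(sK t) -!gmulfM !zF.
  by rewrite /delta1 !mulgA; ring.
have [c zc] := cocycle_represents zz.
rewrite (taub_pullback_eq (F := F) (D := 0) zc) => [|n|g h].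
- by apply/(represents_eq0 (represents_pullback p zc)); exists F.
- rewrite -[i n]mulg1 FM /F r1 -[val f 1%g]addr0.
  have := fM 1%g 1%g; rewrite mulg1 -[LHS]addr0 => /addrI <-.
  by rewrite !addr0 subrr normr0.
- by rewrite zF subrr normr0.
Qed.

(** A quasimorphism of G extending [f] has bounded coboundary, so it meets the criterion with the
    zero cocycle. *)
Lemma taub_pullback_restr f : f \in @restr_hqm R N G i -> taub_pullback f = 0.
Proof.
move=> /restr_hqmP[q /hqmP[[D qD] _] fE].
have [|c zc] := @cocycle_represents R Gamma (fun _ _ => 0).
  by move=> x y t; rewrite addr0 !subrr.
have D0 : 0 <= D by apply: le_trans (qD 1%g 1%g).
rewrite (taub_pullback_eq (F := q) (D := D) zc) => [|n|g h].
- apply/(represents_eq0 (represents_pullback p zc)).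
  by exists (fun=> 0) => x y; rewrite /delta1 subrr addr0.
- by rewrite fE subrr normr0.
- by have := qD g h; congr (_ <= _); congr `|_|; rewrite /delta1; ring.
Qed.

Lemma taub_pullback_ker f : f \in hom_plus_restr R i <-> taub_pullback f = 0.
Proof.
split=> [/subspace_sumP[h [q [hh hq ->]]]|].
  rewrite -[h]scale1r taub_pullback_linear scale1r.
  by rewrite taub_pullback_hom // taub_pullback_restr // addr0.
have [z [c [F [D [zc -> Ff Fz]]]]] := taub_pullback_cocycle f.
move=> /(represents_eq0 (represents_pullback p zc))[w zw].
have zz := represents_cocycle zc; have /invariant_hqmP[fQ fI] := valP f.
have [|q qQ [C qC]] := @homogenization R G (F \- w).
  exists D => g h; have := Fz g h; rewrite zw; congr (_ <= _); congr `|_|.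
  by rewrite /delta1 /=; ring.
(* On N the coboundary of [w] is the constant [z 1 1]; subtracting this constant makes the
   restriction additive. *)
pose k n : R^o := w (i n) - z 1%g 1%g.
have kM : {morph k : n m / (n * m)%g >-> n + m}.
  move=> n m; have := zw (i n) (i m).
  by rewrite !short_exact_comp1 /delta1 /k gmulfM; lra.
have kI : ginvariant i k.
  (* Since i(y) g = g i(x), and delta w equals [z 1 1] at both pairs, w(i y) = w(i x). *)
  move=> g x y e; rewrite /k; have := zw (i y) g; have := zw g (i x).
  rewrite !short_exact_comp1 cocycle2_1l // cocycle2_1r // e /delta1 mulgVK.
  by lra.
have kH : homogeneous k.
  have k1 : k 1%g = 0 by have := kM 1%g 1%g; rewrite mulg1; lra.
  have kX x n : k (x ^+ n)%g = n%:R * k x.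
    elim: n => [|n IHn]; first by rewrite mul0r.
    by rewrite expgS kM IHn -natr1 mulrDl mul1r addrC.
  move=> x [n|n]; rewrite /expgz ?kX // NegzE mulrNz mulNr -[_%:~R]/(n.+1%:R).
  have := kM (x ^+ n.+1)%g (x ^- n.+1)%g; rewrite mulgV k1 kX => /eqP.
  by rewrite eq_sym addrC addr_eq0 => /eqP.
have kQ : k \in @invariant_hqm R N G i.
  apply/invariant_hqmP; split=> //; apply/hqmP; split=> //.
  by exists 0 => n m; rewrite kM -addrA -opprD subrr normr0.
have fE n : val f n = k n + q (i n).
  have /hqmP[_ fH] := fQ; have /hqmP[_ qH] := qQ.
  (* Both sides are homogeneous, and on N both are close to [F], so they coincide. *)
  apply: (@homogeneous_bounded_eq R N (val f) (fun n => k n + q (i n))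
            (D + C + `|z 1%g 1%g|)) => //.
    move=> x m; rewrite mulrDr -kH; congr (_ + _); rewrite -[RHS]qH; congr q.
    exact: ghom_expgz.
  move=> x; have := Ff x; have := qC (i x); have := ler_norm (z 1%g 1%g).
  have := ler_norm (- z 1%g 1%g); rewrite normrN /k /= !ler_norml.
  by move=> ? ? /andP[? ?] /andP[? ?]; apply/andP; split; lra.
apply/subspace_sumP; exists (Submod kQ), (f - Submod kQ); split.
- exact/invariant_homP.
- apply/restr_hqmP; exists q => //; apply/funext => n.
  transitivity (val f n - k n : R); first by [].
  by rewrite fE addrC addKr.
- by rewrite addrC subrK.
Qed.

Lemma taub_pullback_im (y : gH R G 2) :
  y \in im_pullback_comparison R p <-> exists f, taub_pullback f = y.
Proof.
split; last first.
  move=> [f <-]; have [z [c [F [D [zc -> Ff Fz]]]]] := taub_pullback_cocycle f.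
  apply/andP; split; first by apply/lin_imP; exists c.
  by apply/(represents_comparison (represents_pullback p zc)); exists F, D.
move=> /andP[/lin_imP[c <-]]; have [z zc] := represents_ex c.
move=> /(represents_comparison (represents_pullback p zc))[w [D zw]].
have zz := represents_cocycle zc.
have [|q qQ [C qC]] := @homogenization R N (fun n => w (i n)).
  exists (D + `|z 1%g 1%g|) => n m; have := zw (i n) (i m).
  have := ler_norm (z 1%g 1%g); have := ler_norm (- z 1%g 1%g).
  rewrite normrN !short_exact_comp1 gmulfM /delta1 !ler_norml.
  by move=> ? ? /andP[? ?]; apply/andP; split; lra.
have /hqmP[_ qH] := qQ.
have qI : ginvariant i q.
  move=> g x t e; apply/eqP; rewrite -subr_eq0; apply/eqP.
  (* From t^n g = g x^n in G, the values of [w] at t^n and x^n differ by at most 2D, and replacing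
     [w] by [q] costs 2C, uniformly in n. *)
  apply: (bounded_multiples_eq0 (D := 2 * D + 2 * C)) => n.
  have eX : i (t ^+ n)%g = (g * i (x ^+ n) * g^-1)%g.
    elim: n => [|n IHn]; first by rewrite !expg0 !ghom1 mulg1 mulgV.
    by rewrite !expgS !gmulfM e IHn !mulgA mulgVK.
  rewrite mulrBr -!homogeneousX //.
  have := zw (i (t ^+ n)%g) g; have := zw g (i (x ^+ n)%g).
  have := qC (x ^+ n)%g; have := qC (t ^+ n)%g.
  rewrite !short_exact_comp1 cocycle2_1l // cocycle2_1r // /delta1 eX mulgVK.
  rewrite !ler_norml => /andP[? ?] /andP[? ?] /andP[? ?] /andP[? ?].
  by apply/andP; split; lra.
have fQ : q \in @invariant_hqm R N G i by apply/invariant_hqmP.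
have D0 : 0 <= D by apply: le_trans (zw 1%g 1%g).
have C0 : 0 <= C by apply: le_trans (qC 1%g).
(* Here [w] itself plays the role of [F], being within [C] of [q] on N. *)
exists (Submod fQ); apply: (taub_pullback_eq (F := w) (D := D + C) zc) => [n|g h].
  by rewrite distrC (le_trans (qC n)) // lerDr.
by rewrite (le_trans (zw g h)) // lerDl.
Qed.
End ExtensionTheory.

Theorem theorem1p10 (R : realType) (N G Gamma : groupType)
    (i : {multiplicative N -> G}) (p : {multiplicative G -> Gamma})
    (Hexact : short_exact i p) (Hacyclic : boundedly_acyclic R Gamma 3) :
  (exists Phi : {linear quotmod (hom_plus_restr R i) ->
                        submod (im_pullback_comparison R p)},
     bijective Phi /\
     forall f : QNG R i,
       submod_val (Phi (qpi (hom_plus_restr R i) f)) =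
       pullback R p 2 (xi4_inv (taub p f))) /\
  dim_le (quotmod (hom_plus_restr R i)) (gH R G 2).
Proof.
pose psi : {linear QNG R i -> gH R G 2} :=
  HB.pack (@taub_pullback R N G Gamma i p) (GRing.isLinear.Build R _ _ _ _
    (taub_pullback_linear Hexact Hacyclic)).
have [Phi [Phi_bij PhiE]] := @first_isomorphism R _ _ psi
  (hom_plus_restr R i) (im_pullback_comparison R p)
  (taub_pullback_ker Hexact Hacyclic) (taub_pullback_im Hexact Hacyclic).
split; first by exists Phi.
pose incl : {linear submod (im_pullback_comparison R p) -> gH R G 2} := val.
pose inclPhi : {linear quotmod (hom_plus_restr R i) -> gH R G 2} :=
  incl \o Phi.
apply: (@injective_dim_le R _ _ inclPhi).
exact: inj_comp val_inj (bij_inj Phi_bij).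
Qed.
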